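(* Let $K$ be a field containing $\mathbb{R}$ as a subfield, let $v_1,\ldots,v_m\in\mathbb{N}^s$, let $\mathcal{P}=\mathrm{conv}(v_1,\ldots,v_m)$, and let $w_1,\ldots,w_p:\mathbb{R}^s\to\mathbb{R}$ be linear functions with $w_i(e_j)\in\mathbb{N}$ for all $i,j$. Let $\mathcal{P}_w$, $\mathcal{H}_{\mathcal{P}_w}$ and $\Gamma$ be the $r$-weight lifting polytope and the associated sets defined in the context. Then (a) $\mathbb{R}_+\Gamma\cap\mathbb{Z}^{s+p+1}=\mathbb{N}\mathcal{H}_{\mathcal{P}_w}$, that is, $\mathcal{H}_{\mathcal{P}_w}$ is a Hilbert basis of $\mathbb{R}_+\Gamma$; (b) $A_r^w(\mathcal{P})=K[\mathbb{N}\mathcal{H}_{\mathcal{P}_w}]$; (c) $A(\mathcal{P}_w)=A_r^w(\mathcal{P})$; (d) $E_{\mathcal{P}_w}(n)=E_{\mathcal{P}}^{s,\prod_{i=1}^p(w_i+1)}(n)$ for $n\ge0$; (e) the $r$-weighted multivariate Ehrhart series $F_{\mathcal{P}}^{r,w}(t,q,x)$ of $\mathcal{P}$ is a rational function.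
   Context: $\mathbb{N}=\{0,1,2,\ldots\}$; $e_j$ denotes a unit vector. For a lattice polytope $\mathcal{Q}\subset\mathbb{R}^N$, $\mathrm{cone}(\mathcal{Q})\subset\mathbb{R}^{N+1}$ is the cone generated by $\{(x,1):x\in\mathcal{Q}\cap\mathbb{Z}^N\}$, $E_{\mathcal{Q}}(n)=|n\mathcal{Q}\cap\mathbb{Z}^N|$, and the Ehrhart ring $A(\mathcal{Q})$ is the $K$-algebra generated by the monomials $y^az^n$ with $(a,n)\in\mathrm{cone}(\mathcal{Q})\cap\mathbb{Z}^{N+1}$; for $\mathcal{Q}\subset\mathbb{R}^{s+p}$ the $y$-variables are $t_1,\ldots,t_s,q_1,\ldots,q_p$. Fix a finite set $\mathcal{H}_{\mathcal{P}}=\{(c_1,d_1),\ldots,(c_r,d_r)\}$ with $c_i\in\mathbb{N}^s$, $d_i\in\mathbb{N}$, which is a Hilbert basis of $\mathrm{cone}(\mathcal{P})$, meaning $\mathrm{cone}(\mathcal{P})\cap\mathbb{Z}^{s+1}=\mathbb{N}\mathcal{H}_{\mathcal{P}}$, where $\mathbb{N}\mathcal{H}$ is the semigroup of $\mathbb{N}$-linear combinations of elements of $\mathcal{H}$. Define $\mathcal{G}=\{(v_i,0)+w_{j_1}(v_i)e_{s+j_1}+\cdots+w_{j_k}(v_i)e_{s+j_k}\mid1\le i\le m,\ 1\le j_1<\cdots<j_k\le p\}\subset\mathbb{R}^{s+p}$, where $k=0$ is allowed (giving $(v_i,0)\in\mathcal{G}$); $\mathcal{P}_w=\mathrm{conv}(\mathcal{G})$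 (the $r$-weight lifting polytope); $\Gamma=\{(\alpha,1)\mid\alpha\in\mathcal{G}\}\subset\mathbb{R}^{s+p+1}$, with $\mathbb{R}_+\Gamma$ the cone it generates; $\mathcal{H}_{\mathcal{P}_w}=\{(c_i,b,d_i)\mid b=(b_1,\ldots,b_p)\in\mathbb{N}^p,\ 0\le b_j\le w_j(c_i)\ \forall j,\ c_i\in d_i\mathcal{P},\ 1\le i\le r\}$. The $r$-weighted Ehrhart ring is the monomial subring $A_r^w(\mathcal{P})=K[t^aq_1^{b_1}\cdots q_p^{b_p}z^n\mid(a,n)\in\mathrm{cone}(\mathcal{P})\cap\mathbb{Z}^{s+1},\ b_i\in\mathbb{Z},\ 0\le b_i\le w_i(a)\text{ for all }i]$. $K[\mathbb{N}\mathcal{H}_{\mathcal{P}_w}]$ is the subring $K[t^aq^bz^n\mid(a,b,n)\in\mathbb{N}\mathcal{H}_{\mathcal{P}_w}]$. For a function $f$ on $\mathbb{Z}^s$, the $s$-weighted Ehrhart function is $E_{\mathcal{P}}^{s,f}(n)=\sum_{a\in n\mathcal{P}\cap\mathbb{Z}^s}f(a)$ (the superscript $s$ names the weighting). The $r$-weighted multivariate Ehrhart series is $F_{\mathcal{P}}^{r,w}(t,q,x)=\sum t^aq_1^{b_1}\cdots q_p^{b_p}x^n$, summed over $(a,n)\in\mathrm{cone}(\mathcal{P})\cap\mathbb{Z}^{s+1}$ and integers $0\le b_i\le w_i(a)$, $i=1,\ldots,p$; a power series is called a rational function if it is the expansion of one. *)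

(* Defs.v *)
From HB Require Import structures.
From mathcomp Require Import all_boot all_order all_algebra.
From mathcomp Require Import fraction finmap mpoly.
From mathcomp Require Import boolp classical_sets cardinality fsbigop reals.

Set Implicit Arguments.
Unset Strict Implicit.
Unset Printing Implicit Defensive.

Import Order.TTheory GRing.Theory Num.Theory.

Local Open Scope classical_set_scope.
Local Open Scope ring_scope.

Definition nat_to_int (N : nat) (a : 'rV[nat]_N) : 'rV[int]_N := map_mx Posz a.

Definition int_to_real (R : realType) (N : nat) (a : 'rV[int]_N) : 'rV[R]_N :=
  map_mx (fun z : int => z%:~R) a.

Definition nat_to_real (R : realType) (N : nat) (a : 'rV[nat]_N) : 'rV[R]_N :=
  int_to_real R (nat_to_int a).

Definition integer_points (R : realType) (N : nat) (A : set 'rV[R]_N) :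
    set 'rV[int]_N :=
  [set a | A (int_to_real R a)].

Definition conv (R : realType) (N : nat) (A : set 'rV[R]_N) : set 'rV[R]_N :=
  [set x | exists (k : nat) (y : 'I_k -> 'rV[R]_N) (l : 'I_k -> R),
     [/\ forall i, A (y i), forall i, 0 <= l i, \sum_i l i = 1
       & x = \sum_i l i *: y i]].

Definition generated_cone (R : realType) (N : nat) (A : set 'rV[R]_N) :
    set 'rV[R]_N :=
  [set x | exists (k : nat) (y : 'I_k -> 'rV[R]_N) (l : 'I_k -> R),
     [/\ forall i, A (y i), forall i, 0 <= l i & x = \sum_i l i *: y i]].

Definition dilate (R : realType) (N n : nat) (A : set 'rV[R]_N) : set 'rV[R]_N :=
  [set n%:R *: x | x in A].

Definition polytope_cone (R : realType) (N : nat) (Q : set 'rV[R]_N) :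
    set 'rV[R]_(N + 1) :=
  generated_cone
    [set row_mx (int_to_real R x) 1%:M | x in integer_points Q].

Definition nat_span (N : nat) (H : set 'rV[int]_N) : set 'rV[int]_N :=
  [set x | exists (k : nat) (y : 'I_k -> 'rV[int]_N) (l : 'I_k -> nat),
     (forall i, H (y i)) /\ x = \sum_i y i *+ l i].

Definition hilbert_basis (R : realType) (N : nat)
    (H : set 'rV[int]_N) (C : set 'rV[R]_N) : Prop :=
  integer_points C = nat_span H.

(* [fset_set] returns the empty set on infinite sets and [\sum_(_ \in _)] is 0
   on infinite supports; neither happens for polytopes, which are bounded. *)
Definition ehrhart (R : realType) (N : nat) (Q : set 'rV[R]_N) (n : nat) : nat :=
  #|` fset_set (integer_points (dilate n Q))|.

Definition weighted_ehrhart (R : realType) (N : nat) (Q : set 'rV[R]_N)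
    (f : 'rV[int]_N -> R) (n : nat) : R :=
  \sum_(a \in integer_points (dilate n Q)) f a.

(* Exponents of monomials are integral, so monomial subrings live in the field
   of rational functions in N variables over K. *)
Definition ratfun (K : fieldType) (N : nat) : fieldType :=
  {fraction {mpoly K[N]}}.

Definition monomial (K : fieldType) (N : nat) (a : 'rV[int]_N) : ratfun K N :=
  \prod_(i < N) (tofrac ('X_i : {mpoly K[N]})) ^ (a ord0 i).

Definition is_subalgebra (K : fieldType) (N : nat) (B : set (ratfun K N)) : Prop :=
  [/\ forall c : K, B (tofrac (c%:MP : {mpoly K[N]})),
      forall f g, B f -> B g -> B (f + g)
    & forall f g, B f -> B g -> B (f * g)].

Definition monomial_subring (K : fieldType) (N : nat) (S : set 'rV[int]_N) :
    set (ratfun K N) :=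
  smallest (@is_subalgebra K N) [set monomial K a | a in S].
Arguments monomial_subring K {N} S _.

Definition ehrhart_ring (R : realType) (K : fieldType) (N : nat)
    (Q : set 'rV[R]_N) : set (ratfun K (N + 1)) :=
  monomial_subring K (integer_points (polytope_cone Q)).
Arguments ehrhart_ring {R} K {N} Q _.

(* Formal series are written as coefficient functions on the integer exponents;
   a power series is one supported on nonnegative exponents. *)
Definition is_power_series (k : fieldType) (N : nat) (F : 'rV[int]_N -> k) : Prop :=
  forall a, F a != 0 -> forall i, 0 <= a ord0 i.

Definition mnm_to_int (N : nat) (u : 'X_{1..N}) : 'rV[int]_N :=
  \row_i Posz (u i).

(* phi = f / g with g(0) != 0 and g * F = f coefficientwise; the condition on
   g(0) makes g invertible as a power series, so that F is determined by phi. *)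
Definition is_expansion (k : fieldType) (N : nat) (phi : ratfun k N)
    (F : 'rV[int]_N -> k) : Prop :=
  is_power_series F /\
  exists f g : {mpoly k[N]},
    [/\ g@_0%MM != 0, phi = tofrac f / tofrac g
      & forall u : 'X_{1..N},
          \sum_(v <- msupp g) g@_v * F (mnm_to_int u - mnm_to_int v) = f@_u].

Definition is_rational_function (k : fieldType) (N : nat)
    (F : 'rV[int]_N -> k) : Prop :=
  exists phi : ratfun k N, is_expansion phi F.

Definition sum_of_monomials (k : fieldType) (N : nat) (S : set 'rV[int]_N) :
    'rV[int]_N -> k :=
  fun a => if `[< S a >] then 1 else 0.
Arguments sum_of_monomials k {N} S _.

Definition lattice_polytope (R : realType) (s m : nat) (v : 'I_m -> 'rV[nat]_s) :
    set 'rV[R]_s :=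
  conv (range (fun i => nat_to_real R (v i))).
Arguments lattice_polytope R {s m} v _.

(* The indices j_1 < ... < j_k are the elements of the subset J of 'I_p. *)
Definition lifting_points (R : realType) (s p m : nat) (v : 'I_m -> 'rV[nat]_s)
    (w : 'I_p -> {linear 'rV[R]_s -> R^o}) : set 'rV[R]_(s + p) :=
  [set x | exists (i : 'I_m) (J : {set 'I_p}),
     x = row_mx (nat_to_real R (v i)) 0
         + \sum_(j in J) w j (nat_to_real R (v i)) *: delta_mx ord0 (rshift s j)].

Definition lifting_polytope (R : realType) (s p m : nat) (v : 'I_m -> 'rV[nat]_s)
    (w : 'I_p -> {linear 'rV[R]_s -> R^o}) : set 'rV[R]_(s + p) :=
  conv (lifting_points v w).

Definition lifting_Gamma (R : realType) (s p m : nat) (v : 'I_m -> 'rV[nat]_s)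
    (w : 'I_p -> {linear 'rV[R]_s -> R^o}) : set 'rV[R]_(s + p + 1) :=
  [set row_mx alpha 1%:M | alpha in lifting_points v w].

Definition base_vectors (s r : nat) (c : 'I_r -> 'rV[nat]_s) (d : 'I_r -> nat) :
    set 'rV[int]_(s + 1) :=
  range (fun i => row_mx (nat_to_int (c i)) (Posz (d i))%:M).

Definition lifted_vectors (R : realType) (s p r : nat) (P : set 'rV[R]_s)
    (w : 'I_p -> {linear 'rV[R]_s -> R^o})
    (c : 'I_r -> 'rV[nat]_s) (d : 'I_r -> nat) : set 'rV[int]_(s + p + 1) :=
  [set x | exists (i : 'I_r) (b : 'rV[nat]_p),
     [/\ forall j, (b ord0 j)%:R <= (w j (nat_to_real R (c i)) : R),
         dilate (d i) P (nat_to_real R (c i))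
       & x = row_mx (row_mx (nat_to_int (c i)) (nat_to_int b)) (Posz (d i))%:M]].

Definition weighted_exponents (R : realType) (s p : nat) (P : set 'rV[R]_s)
    (w : 'I_p -> {linear 'rV[R]_s -> R^o}) : set 'rV[int]_(s + p + 1) :=
  [set x | exists (a : 'rV[int]_s) (b : 'rV[int]_p) (n : int),
     [/\ integer_points (polytope_cone P) (row_mx a n%:M),
         forall i, 0 <= b ord0 i /\
           (b ord0 i)%:~R <= (w i (int_to_real R a) : R)
       & x = row_mx (row_mx a b) n%:M]].

Definition weighted_ehrhart_ring (R : realType) (K : fieldType) (s p : nat)
    (P : set 'rV[R]_s) (w : 'I_p -> {linear 'rV[R]_s -> R^o}) :
    set (ratfun K (s + p + 1)) :=
  monomial_subring K (weighted_exponents P w).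
Arguments weighted_ehrhart_ring {R} K {s p} P w _.

(* The series has integer coefficients, so rationality is considered over the
   prime field. *)
Definition weighted_ehrhart_series (R : realType) (s p : nat)
    (P : set 'rV[R]_s) (w : 'I_p -> {linear 'rV[R]_s -> R^o}) :
    'rV[int]_(s + p + 1) -> rat :=
  sum_of_monomials rat (weighted_exponents P w).

(* Main.v *)
Require Import Defs.
From HB Require Import structures.
From mathcomp Require Import all_boot all_order all_algebra.
From mathcomp Require Import fraction finmap mpoly.
From mathcomp Require Import boolp classical_sets cardinality fsbigop reals.

(** Write E for the set of integer exponents (a, b, n) with (a, n) in the cone
    of P and 0 <= b_j <= w_j(a). Everything reduces to describing E in two
    ways.

    E is the set of integer points of R_+ Gamma ([integer_points_Gamma]). The
    inequalities hold at the generators, hence on the cone they span.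
    Conversely put b_j = theta_j w_j(a) with theta_j in [0, 1]. The map
    (a, n) |-> (a, theta w(a), n) is linear, so it is enough to treat a vertex
    v_i of P; there (theta_j w_j(v_i))_j is a point of the box with corners
    (w_j(v_i) [j in J])_j, and it is the mean of these corners when each j is
    put in J independently with probability theta_j ([lift_by_cube],
    [Gamma_coneP]).

    E is also the monoid generated by the lifted Hilbert basis
    ([nat_span_lifted_vectors]): when (a, n) is a sum of vectors (c_i, d_i),
    the integer b_j <= w_j(a) = sum of the w_j(c_i) is shared greedily among
    the summands.

    This gives the Hilbert basis. The lifting polytope is the convex hull of
    integer points, so its cone is R_+ Gamma ([polytope_cone_lifting]) and the
    three rings are generated by the same monomials. The Ehrhart function is
    found by slicing E at height n: above a lies a box with
    prod (w_j(a) + 1) integer points ([ehrhart_lifting]).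

    Finally, the series of any monoid S generated by finitely many nonzero
    nonnegative vectors h_1, ..., h_k is rational with denominator
    prod (1 - X^h_i) ([rational_monoid]). The proof is by induction on k, for
    the series of S \ I with I an ideal of S. Writing each element of S as
    n h + b with n minimal and b in the monoid S' of the other generators
    cuts S \ I into slices n h + (S' \ J_n), where the J_n are increasing
    ideals of S'. By Dickson's lemma ([ideal_fg]) the J_n are eventually
    constant, so the slices eventually form a geometric series of ratio X^h
    ([iterated_difference_ideal_complement]). *)

Set Implicit Arguments.
Unset Strict Implicit.
Unset Printing Implicit Defensive.

Import Order.TTheory GRing.Theory Num.Theory.

Local Open Scope classical_set_scope.
Local Open Scope ring_scope.

(** * Ideals of a finitely generated commutative monoid *)

Section MonoidIdeals.
Variable V : zmodType.
Implicit Types (hs : seq V) (I : set V).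

(** Recursion on the list of generators makes the decomposition x = n h + b,
    on which all inductions below rest, hold by computation. *)
Fixpoint monoid_of hs : set V :=
  if hs is h :: hs' then
    [set x | exists n : nat, exists2 b, monoid_of hs' b & x = h *+ n + b]
  else [set 0].

Lemma monoid_of0 hs : monoid_of hs 0.
Proof.
by elim: hs => [//|h hs IH] /=; exists 0%N, 0 => //; rewrite mulr0n addr0.
Qed.

Lemma monoid_ofD hs x y : monoid_of hs x -> monoid_of hs y ->
  monoid_of hs (x + y).
Proof.
elim: hs x y => [|h hs IH] x y /=; first by move=> -> ->; rewrite addr0.
move=> [n [b Sb ->]] [k [b' Sb' ->]]; exists (n + k)%N, (b + b').
  exact: IH.
by rewrite mulrnDr addrACA.
Qed.

Lemma monoid_of_mem hs h : h \in hs -> monoid_of hs h.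
Proof.
elim: hs => // h' hs IH; rewrite inE => /predU1P[->|/IH Sh] /=.
  by exists 1%N, 0; [exact: monoid_of0|rewrite addr0].
by exists 0%N, h => //; rewrite mulr0n add0r.
Qed.

Lemma monoid_of_ind hs (P : V -> Prop) : P 0 ->
  (forall x y, P x -> P y -> P (x + y)) -> (forall h, h \in hs -> P h) ->
  forall x, monoid_of hs x -> P x.
Proof.
move=> P0 PD; elim: hs => [|h hs IH] Phs x /=; first by move=> ->.
case=> n [b Sb ->]; apply: (PD).
  elim: n => [|n IHn]; rewrite ?mulr0n // mulrS.
  by apply: PD => //; apply: Phs; rewrite mem_head.
by apply: IH => // h' h'in; apply: Phs; rewrite inE h'in orbT.
Qed.

Definition monoid_ideal hs I :=
  I `<=` monoid_of hs /\ forall x y, I x -> monoid_of hs y -> I (x + y).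

Definition ideal_generated_by hs I (B : seq V) :=
  (forall b, b \in B -> I b) /\
  forall x, I x -> exists2 b, b \in B & monoid_of hs (x - b).

Definition ascending (J : nat -> set V) := forall n, J n `<=` J n.+1.

Lemma ascending_le (J : nat -> set V) n k : ascending J -> (n <= k)%N ->
  J n `<=` J k.
Proof.
move=> Jasc /subnK <-; elim: (k - n)%N => // i IH x /IH /Jasc.
by rewrite addSn.
Qed.

(** The union of the chain is an ideal, and its finitely many generators
    already lie in one term of the chain. Finite generation is a hypothesis
    because [ideal_fg] uses this for a monoid with one generator less. *)
Lemma stationary_of_fg hs (J : nat -> set V) :
  (forall I, monoid_ideal hs I -> exists B, ideal_generated_by hs I B) ->
  (forall n, monoid_ideal hs (J n)) -> ascending J ->
  exists n0, forall n, J n `<=` J n0.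
Proof.
move=> fg Jid Jasc.
pose U := [set x | exists n, J n x].
have Uid : monoid_ideal hs U.
  split=> [x [n]|x y [n Jx] Sy]; first by apply: (Jid n).1.
  by exists n; apply: (Jid n).2.
have [B [BU genU]] := fg _ Uid.
have [n0 Bn0] : exists n0, forall b, b \in B -> J n0 b.
  elim: B BU {genU} => [|b B IH] BU; first by exists 0%N.
  have [|n1 Bn1] := IH; first by move=> x xB; apply: BU; rewrite inE xB orbT.
  have [n2 Jb] : U b by apply: BU; rewrite mem_head.
  exists (maxn n1 n2) => x; rewrite inE => /predU1P[->|/Bn1].
    exact: ascending_le (leq_maxr _ _) _ Jb.
  exact: ascending_le (leq_maxl _ _) _.
exists n0 => n x Jx; have [|b bB Sxb] := genU x; first by exists n.
by rewrite -(subrK b x) addrC; apply: (Jid n0).2 => //; apply: Bn0.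
Qed.

(** Dickson's lemma, by induction on the number of generators. The slices
    J n = {b | n h + b in I} are ideals of the smaller monoid and increase
    with n, so they are constant from some n0 on; generators of the slices
    up to n0, put back at their heights, generate I. *)
Lemma ideal_fg hs I : monoid_ideal hs I -> exists B, ideal_generated_by hs I B.
Proof.
elim: hs I => [|h hs IH] I [Isub ID].
  have [I0|I0] := pselect (I 0).
    exists [:: 0]; split=> [b|x /Isub /= ->]; first by rewrite inE => /eqP ->.
    by exists 0; rewrite ?inE // subrr.
  by exists [::]; split=> // x Ix; case: I0; rewrite -(Isub x Ix : x = 0).
pose J n := [set b | monoid_of hs b /\ I (h *+ n + b)].
have hsS b : monoid_of hs b -> monoid_of (h :: hs) b.
  by move=> Sb; exists 0%N, b; rewrite ?mulr0n ?add0r.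
have Jid n : monoid_ideal hs (J n).
  split=> [x []//|x y [Sx Ix] Sy]; split; first exact: monoid_ofD.
  by rewrite addrA; apply: ID; [exact: Ix|exact: hsS].
have Jasc : ascending J.
  move=> n b [Sb Ib]; split=> //; rewrite mulrSr addrAC.
  by apply: ID => //; apply: monoid_of_mem; rewrite mem_head.
have [n0 Jn0] := stationary_of_fg IH Jid Jasc.
have [B JB] := choice (fun n => IH _ (Jid n)).
exists [seq h *+ n + b | n <- iota 0 n0.+1, b <- B n]; split.
  by move=> b /allpairsPdep[n [b' [_ b'B ->]]]; case: (JB n) => + _ => /(_ _ b'B)[].
move=> x Ix; have [n [b Sb xE]] := Isub x Ix; rewrite xE in Ix *.
(* Take k = min(n, n0): beyond n0 the generators at height n0 suffice, and
   the n - k copies of h left over belong to the monoid. *)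
wlog [k le_k Jk] : / exists2 k, (k <= n0)%N /\ (k <= n)%N & J k b => [WL|].
  have [le_n|lt_n] := leqP n n0; first by apply: WL; exists n.
  by apply: WL; exists n0; [split=> //; exact: ltnW|apply: (Jn0 n)].
have [b' b'B Sb'] := (JB k).2 b Jk.
exists (h *+ k + b').
  by apply/allpairsPdep; exists k, b'; rewrite mem_iota leq0n ltnS le_k.1.
exists (n - k)%N, (b - b') => //.
by rewrite opprD addrACA -mulrnBr ?le_k.2.
Qed.

Lemma ascending_ideals_stationary hs (J : nat -> set V) :
  (forall n, monoid_ideal hs (J n)) -> ascending J ->
  exists n0, forall n, J n `<=` J n0.
Proof. exact/stationary_of_fg/ideal_fg. Qed.

End MonoidIdeals.

(** * Series of monoids and their differences *)

Section Series.
Variables (k : fieldType) (N : nat).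
Implicit Types (F G : 'rV[int]_N -> k) (g : {mpoly k[N]}).
Local Notation exponent := (@mnm_to_int N).

Lemma mnm_to_intD (u v : 'X_{1..N}) :
  exponent (u + v)%MM = exponent u + exponent v.
Proof. by apply/rowP => i; rewrite !mxE mnmDE. Qed.

Lemma mnm_to_int0 : exponent 0%MM = 0.
Proof. by apply/rowP => i; rewrite !mxE mnm0E. Qed.

Lemma mnm_to_int_inj : injective exponent.
Proof. by move=> u v /rowP uv; apply/mnmP => i; have := uv i; rewrite !mxE => -[]. Qed.

Definition mul_series g F : 'rV[int]_N -> k :=
  fun a => \sum_(v <- msupp g) g@_v * F (a - exponent v).

(** Polynomials with different supports can be compared once their sums run
    over a common list of exponents. *)
Lemma mul_series_subset g F (r : seq 'X_{1..N}) a :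
  uniq r -> {subset msupp g <= r} ->
  mul_series g F a = \sum_(v <- r) g@_v * F (a - exponent v).
Proof.
move=> Ur sub; rewrite (bigID (mem (msupp g))) /= [X in _ + X]big1 ?addr0; last first.
  by move=> v /memN_msupp_eq0 ->; rewrite mul0r.
rewrite -big_filter; apply: perm_big; apply: uniq_perm.
- exact: msupp_uniq.
- exact: filter_uniq.
- by move=> v; rewrite mem_filter; case: (boolP (v \in _)) => // /sub ->.
Qed.

Lemma mul_seriesB g1 g2 F a :
  mul_series (g1 - g2) F a = mul_series g1 F a - mul_series g2 F a.
Proof.
pose r := undup (msupp g1 ++ msupp g2).
have Ur : uniq r by apply: undup_uniq.
rewrite !(@mul_series_subset _ F r) // => [|v|v|v].
- by rewrite -sumrB; apply: eq_bigr => v _; rewrite mcoeffB mulrBl.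
- by rewrite mem_undup mem_cat => ->; rewrite orbT.
- by rewrite mem_undup mem_cat => ->.
- by rewrite mem_undup; apply: msuppB_le.
Qed.

Lemma mul_seriesMX g h F a :
  mul_series (g * 'X_[h]) F a = mul_series g (fun b => F (b - exponent h)) a.
Proof.
rewrite /mul_series (perm_big _ (msuppMX g h)) big_map; apply: eq_bigr => v _.
by rewrite mcoeffMX mnm_to_intD opprD addrA addrAC.
Qed.

Definition difference (h : 'X_{1..N}) F : 'rV[int]_N -> k :=
  fun a => F a - F (a - exponent h).

Fixpoint iterated_difference (hs : seq 'X_{1..N}) F :=
  if hs is h :: hs' then iterated_difference hs' (difference h F) else F.

Definition denominator (hs : seq 'X_{1..N}) : {mpoly k[N]} :=
  \prod_(h <- hs) (1 - 'X_[h]).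

(** Multiplying by 1 - X^h is the difference operator F(a) - F(a - h), so the
    product with the whole denominator is computed one generator at a time. *)
Lemma mul_series_denominator hs F :
  mul_series (denominator hs) F = iterated_difference hs F.
Proof.
elim: hs F => [|h hs IH] F; rewrite /denominator.
  apply/funext => a; rewrite big_nil /mul_series msupp1 big_seq1.
  by rewrite mcoeff1 eqxx mul1r mnm_to_int0 subr0.
rewrite big_cons -/(denominator hs) mulrC mulrBr mulr1 /= -IH.
apply/funext => a; rewrite mul_seriesB mul_seriesMX /mul_series -sumrB.
by apply: eq_bigr => v _; rewrite -mulrBr.
Qed.

(** The constant term is multiplicative, and is 1 for each factor: only
    h = 0 would give the factor 0. *)
Lemma denominator0 hs : 0%MM \notin hs -> (denominator hs)@_0%MM = 1.
Proof.
move=> hs0; rewrite /denominator rmorph_prod big_seq big1 // => h h_hs.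
rewrite /= mcoeffB mcoeff1 mcoeffX eqxx; case: eqVneq => [h0|_]; last by rewrite subr0.
by rewrite -h0 h_hs in hs0.
Qed.

(** Differences are linear and commute with translations. *)
Lemma iterated_difference_comb hs x y h F G :
  iterated_difference hs (fun a => x * F a + y * G (a - h)) =
  (fun a => x * iterated_difference hs F a + y * iterated_difference hs G (a - h)).
Proof.
elim: hs F G => [//|h' hs IH] F G; rewrite /= -IH; congr iterated_difference.
apply/funext => a; rewrite /difference !mulrBr opprD addrACA.
by rewrite (addrAC a).
Qed.

(** The exponents range over 'X_{1..N}, so this also says that no monomial
    has a negative exponent. *)
Definition polynomial_series F :=
  exists r : seq 'X_{1..N},
    forall a, F a != 0 -> exists2 u, u \in r & a = exponent u.

Lemma polynomial_series_comb x y h F G :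
  polynomial_series F -> polynomial_series G ->
  polynomial_series (fun a => x * F a + y * G (a - exponent h)).
Proof.
move=> [r rF] [q qG]; exists (r ++ [seq (u + h)%MM | u <- q]) => a.
have [F0|/rF[u ur ->] _] := eqVneq (F a) 0; last first.
  by exists u; rewrite ?mem_cat ?ur.
have [G0|/qG[u uq uE] _] := eqVneq (G (a - exponent h)) 0.
  by rewrite F0 G0 !mulr0 addr0 eqxx.
exists (u + h)%MM; first by rewrite mem_cat; apply/orP; right; apply/mapP; exists u.
by rewrite mnm_to_intD -uE subrK.
Qed.

(** The differenced series is the numerator and [denominator hs] the
    denominator of the rational function. *)
Lemma rational_of_polynomial_difference hs F : 0%MM \notin hs -> is_power_series F ->
  polynomial_series (iterated_difference hs F) -> is_rational_function F.
Proof.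
move=> hs0 powF [r rF]; set G := iterated_difference hs F in rF.
pose f : {mpoly k[N]} := \sum_(u <- undup r) G (exponent u) *: 'X_[u].
exists (tofrac f / tofrac (denominator hs)); split=> //.
exists f, (denominator hs); split=> // [|u].
  by rewrite denominator0 // oner_neq0.
rewrite -[LHS]/(mul_series _ _ _) mul_series_denominator -/G /f raddf_sum /=.
under eq_bigr do rewrite mcoeffZ mcoeffX.
have [ur|ur] := boolP (u \in undup r).
  rewrite (bigD1_seq u) ?undup_uniq //= eqxx mulr1 big1 ?addr0 // => v.
  by move=> /negPf ->; rewrite mulr0.
rewrite big_seq big1 => [|v vr]; last first.
  by case: eqVneq vr ur => [->->//|]; rewrite mulr0.
apply/eqP; apply: contraNT ur => /rF[v vr /mnm_to_int_inj ->].
by rewrite mem_undup.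
Qed.

Local Notation indicator := (@sum_of_monomials k N).

(** Induction on the generators. Let S' be the monoid of all generators but
    the first one, e. An element of the complement of I is n e + b in a unique
    way if b is in S' and n is as small as possible; the b that occur for a
    given n form the complement in S' of an ideal J n, which grows with n and
    is therefore constant for n >= n0. Let B n be this complement and T n the
    union of the slices from n on, translated by - n e. Their series satisfy
    T n = B n + X^e T n.+1. For n >= n0 also T n.+1 = T n, so that
    (1 - X^e) T n = B n, which is settled by induction. A descent from n0 to 0
    reaches T 0, the complement of I. *)
Lemma iterated_difference_ideal_complement hs (I : set 'rV[int]_N) :
  monoid_ideal (map exponent hs) I ->
  polynomial_series
    (iterated_difference hs (indicator (monoid_of (map exponent hs) `\` I))).
Proof.
elim: hs I => [|h hs IH] I [Isub ID].
  exists [:: 0%MM] => a /=; rewrite /sum_of_monomials.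
  case: asboolP => [[-> _] _|_]; last by rewrite eqxx.
  by exists 0%MM; rewrite ?inE ?mnm_to_int0.
set S := monoid_of (map exponent hs) in IH *.
set e := exponent h.
have S_sub b : S b -> monoid_of (map exponent (h :: hs)) b.
  by move=> Sb; exists 0%N, b; rewrite ?mulr0n ?add0r.
have e_in : monoid_of (map exponent (h :: hs)) e.
  by apply: monoid_of_mem; rewrite mem_head.
pose J n := [set b | S b /\ (I (e *+ n + b) \/
  exists i c, [/\ (i < n)%N, S c & e *+ n + b = e *+ i + c])].
have Jid n : monoid_ideal (map exponent hs) (J n).
  split=> [b []//|b y [Sb Jb] Sy]; split; first exact: monoid_ofD.
  case: Jb => [Ib|[i [c [lt_in Sc bE]]]].
    by left; rewrite addrA; apply: ID => //; apply: S_sub.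
  right; exists i, (c + y); split=> //; first exact: monoid_ofD.
  by rewrite !addrA bE.
have Jasc : ascending J.
  move=> n b [Sb Jb]; split=> //; rewrite mulrSr addrAC.
  case: Jb => [Ib|[i [c [lt_in Sc bE]]]]; first by left; apply: ID.
  by right; exists i.+1, c; split=> //; rewrite mulrSr bE addrAC.
have [n0 Jn0] := ascending_ideals_stationary Jid Jasc.
pose B n := S `\` J n.
pose T n := [set x | exists i b, B (n + i)%N b /\ x = e *+ i + b].
(* The union in T n is disjoint: an element of B n that is also in a later
   slice would show that the height of the latter is not minimal. *)
have BT n a : B n a -> T n.+1 (a - e) -> False.
  move=> [Sa _] [i [b [[Sb nJ] aE]]]; apply: nJ; split=> //; right; exists n, a.
  split=> //; first by rewrite addSn ltnS leq_addr.
  have -> : a = e *+ i.+1 + b by rewrite mulrSr addrAC -aE subrK.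
  by rewrite addSn -addnS mulrnDr -addrA.
have TE n a : T n a <-> B n a \/ T n.+1 (a - e).
  split=> [[[|i] [b [Bb ->]]]|[Ba|[i [b [Bb aE]]]]].
  - by left; rewrite addn0 in Bb; rewrite mulr0n add0r.
  - right; exists i, b; split; first by rewrite addSnnS.
    by rewrite mulrSr addrAC addrK.
  - by exists 0%N, a; rewrite addn0 mulr0n add0r.
  - exists i.+1, b; split; first by rewrite -addSnnS.
    by rewrite -[a](subrK e) aE addrAC -mulrSr.
have indT n : indicator (T n) =
    (fun a => 1 * indicator (B n) a + 1 * indicator (T n.+1) (a - e)).
  apply/funext => a; rewrite !mul1r /sum_of_monomials.
  case: asboolP => [/TE[Ba|Ta]|nTa].
  - by rewrite (asboolT Ba) asboolF ?addr0 // => /(BT _ _ Ba).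
  - by rewrite (asboolT Ta) asboolF ?add0r // => /BT /(_ Ta).
  - by rewrite !asboolF ?addr0 // => ?; apply/nTa/TE; [right|left].
have B_poly n : polynomial_series (iterated_difference hs (indicator (B n))).
  exact: IH.
have BE n : (n0 <= n)%N -> B n = B n0.
  move=> le_n; apply/seteqP; split=> b [Sb nJ]; split=> //.
    by move/(ascending_le Jasc le_n).
  by move/Jn0.
have differenceE F : difference h F = fun a => 1 * F a + (-1) * F (a - e).
  by apply/funext => a; rewrite mul1r mulN1r.
(* For n >= n0 the recursion is a geometric series, summed by 1 - X^e. *)
have T_poly_large n : (n0 <= n)%N ->
    polynomial_series (iterated_difference (h :: hs) (indicator (T n))).
  move=> le_n; have TSn : T n.+1 = T n.
    by apply/seteqP; split=> x [i [b [Bb ->]]]; exists i, b; split=> //;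
       move: Bb; rewrite !BE // ?addSn ?leqW // (leq_trans le_n) ?leq_addr.
  rewrite /=; suff -> : difference h (indicator (T n)) = indicator (B n) by [].
  by apply/funext => a; rewrite differenceE {1}indT TSn !mul1r mulN1r addrK.
have T_poly n : polynomial_series (iterated_difference (h :: hs) (indicator (T n))).
  have [|/ltnW/subnK] := leqP n0 n; first exact: T_poly_large.
  move: (n0 - n)%N => i; elim: i n => [|i IHi] n iE.
    by apply: T_poly_large; rewrite -iE.
  rewrite indT iterated_difference_comb; apply: polynomial_series_comb; last first.
    by apply: IHi; rewrite addnS -addSn.
  by rewrite /= differenceE iterated_difference_comb; apply: polynomial_series_comb.
suff -> : monoid_of (map exponent (h :: hs)) `\` I = T 0%N by [].
apply/seteqP; split=> x.
  move=> [Sx nIx].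
  have exn : exists n, `[< exists2 b, S b & x = e *+ n + b >].
    by have [n Sn] := Sx; exists n; apply/asboolP.
  have [n /asboolP[b Sb xE] minn] := ex_minnP exn.
  exists n, b; split=> //; split=> // -[_ []]; rewrite add0n -xE //.
  move=> [i [c [lt_in Sc xE']]].
  have : (n <= i)%N by apply: minn; apply/asboolP; exists c.
  by rewrite leqNgt lt_in.
move=> [i [b [[Sb nJ] ->]]]; split; first by exists i, b.
by move=> Ib; apply: nJ; split=> //; left.
Qed.

Lemma rational_monoid hs : 0%MM \notin hs ->
  is_rational_function (indicator (monoid_of (map exponent hs))).
Proof.
move=> hs0; apply: (rational_of_polynomial_difference hs0) => [a|].
  rewrite /sum_of_monomials; case: asboolP => [Sa _|]; last by rewrite eqxx.
  move: a Sa; apply: monoid_of_ind => [i|a b a0 b0 i|h /mapP[u _ ->] i].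
  - by rewrite mxE.
  - by rewrite mxE addr_ge0.
  - by rewrite mxE.
rewrite -[monoid_of _]setD0; apply: iterated_difference_ideal_complement.
by split=> [x []|x y []].
Qed.

End Series.

(** * Cones over convex hulls *)

Section Cones.
Variables (R : realType) (N : nat).
Implicit Types (A B : set 'rV[R]_N) (x y : 'rV[R]_N).

Lemma generated_cone0 A : generated_cone A 0.
Proof.
by exists 0%N, (fun=> 0), (fun=> 0); split=> [[]//|[]//|]; rewrite big_ord0.
Qed.

Lemma generated_cone_consZ A (l : R) y x : A y -> 0 <= l -> generated_cone A x ->
  generated_cone A (l *: y + x).
Proof.
move=> Ay l0 [k [z [c [Az c0 ->]]]].
exists k.+1, (fun i => oapp z y (unlift ord0 i)), (fun i => oapp c l (unlift ord0 i)).
split=> [i|i|]; [by case: unlift => /=|by case: unlift => /=|].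
rewrite big_ord_recl unlift_none /=; congr (_ + _).
by apply: eq_bigr => i _; rewrite liftK.
Qed.

(** Used to extend a property from the generators to the cone without
    handling families of points and coefficients. *)
Lemma generated_cone_ind A (P : 'rV[R]_N -> Prop) : P 0 ->
  (forall x y, P x -> P y -> P (x + y)) ->
  (forall (l : R) y, 0 <= l -> A y -> P (l *: y)) ->
  forall x, generated_cone A x -> P x.
Proof.
move=> P0 PD PZ x [k [y [l [Ay l0 ->]]]].
by elim/big_ind: _ => // i _; apply: PZ.
Qed.

Lemma generated_coneD A x y : generated_cone A x -> generated_cone A y ->
  generated_cone A (x + y).
Proof.
move=> [k [z [l [Az l0 ->]]]] Ay.
elim/big_rec: _ => [|i a _ Aa]; first by rewrite add0r.
by rewrite -addrA; apply: generated_cone_consZ.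
Qed.

Lemma generated_coneZ A (c : R) x : 0 <= c -> generated_cone A x ->
  generated_cone A (c *: x).
Proof.
move=> c0 [k [z [l [Az l0 ->]]]]; exists k, z, (fun i => c * l i).
split=> // [i|]; first exact: mulr_ge0.
by rewrite scaler_sumr; apply: eq_bigr => i _; rewrite scalerA.
Qed.

Lemma generated_cone_mem A x : A x -> generated_cone A x.
Proof.
move=> Ax; rewrite -[x]scale1r -[_ *: _]addr0.
exact: generated_cone_consZ (generated_cone0 A).
Qed.

Lemma generated_cone_sum A (I : finType) (F : I -> 'rV[R]_N) :
  (forall i, generated_cone A (F i)) -> generated_cone A (\sum_i F i).
Proof.
move=> AF; elim/big_ind: _ => //; first exact: generated_cone0.
exact: generated_coneD.
Qed.

Lemma generated_cone_sub A B : A `<=` generated_cone B ->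
  generated_cone A `<=` generated_cone B.
Proof.
move=> AB; apply: generated_cone_ind; first exact: generated_cone0.
- exact: generated_coneD.
- by move=> l y l0 /AB; apply: generated_coneZ.
Qed.

Lemma conv_mem A x : A x -> conv A x.
Proof.
move=> Ax; exists 1%N, (fun=> x), (fun=> 1).
by split=> // *; rewrite big_ord1 ?scale1r.
Qed.

Definition homogenize A : set 'rV[R]_(N + 1) := [set row_mx x 1%:M | x in A].

End Cones.

Lemma row_mx_sum (V : nmodType) (I : finType) (n1 n2 : nat)
    (F : I -> 'rV[V]_n1) (G : I -> 'rV[V]_n2) :
  \sum_i row_mx (F i) (G i) = row_mx (\sum_i F i) (\sum_i G i).
Proof.
elim/big_rec3: _ => [|i x y z _ ->]; first by rewrite row_mx0.
by rewrite add_row_mx.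
Qed.

Section Homogenization.
Variables (R : realType) (N : nat).
Implicit Types (A : set 'rV[R]_N) (x : 'rV[R]_N).

Lemma row_mx_sumZ (k : nat) (y : 'I_k -> 'rV[R]_N) (l : 'I_k -> R) :
  \sum_i l i *: row_mx (y i) 1%:M =
  row_mx (\sum_i l i *: y i) (\sum_i l i)%:M :> 'rV[R]_(N + 1).
Proof.
under eq_bigr do rewrite scale_row_mx scale_scalar_mx mulr1.
by rewrite row_mx_sum raddf_sum.
Qed.

(** All generators are at height 1, so the height of a combination is the sum
    of its coefficients. *)
Lemma homogenize_coneP A x (t : R) :
  generated_cone (homogenize A) (row_mx x t%:M) <->
  exists (k : nat) (y : 'I_k -> 'rV[R]_N) (l : 'I_k -> R),
     [/\ forall i, A (y i), forall i, 0 <= l i, \sum_i l i = t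
       & x = \sum_i l i *: y i].
Proof.
split=> [[k [z [l [Az l0 xE]]]]|[k [y [l [Ay l0 <- ->]]]]]; last first.
  exists k, (fun i => row_mx (y i) 1%:M), l; split=> // [i|].
    by exists (y i).
  by rewrite row_mx_sumZ.
have /choice[y yP] i : exists y, A y /\ row_mx y 1%:M = z i.
  by have [a Aa aE] := Az i; exists a.
exists k, y, l; move: xE; under eq_bigr do rewrite -(yP _).2.
rewrite row_mx_sumZ => /eq_row_mx[-> tE]; split=> // [i|]; first exact: (yP i).1.
by move/matrixP: tE => /(_ 0 0); rewrite !mxE eqxx.
Qed.

(** For n > 0 one divides the coefficients by n. At n = 0 all coefficients
    vanish; the cone contains 0 in any case, but the dilate of an empty hull
    is empty, whence the condition on A. *)
Lemma dilate_convP A n x : dilate n (conv A) x <->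
  A !=set0 /\ generated_cone (homogenize A) (row_mx x n%:R%:M).
Proof.
rewrite homogenize_coneP; split=> [[z [k [y [l [Ay l0 l1 ->]]]] <-]|].
  split; last first.
    exists k, y, (fun i => n%:R * l i); split=> // [i||].
    - by rewrite mulr_ge0.
    - by rewrite -mulr_sumr l1 mulr1.
    - by rewrite scaler_sumr; apply: eq_bigr => i _; rewrite scalerA.
  case: k y l Ay {l0} l1 => [|k] y l Ay l1; last by exists (y ord0).
  by move: l1; rewrite big_ord0 => /esym/eqP; rewrite oner_eq0.
move=> [[z Az] [k [y [l [Ay l0 lE ->]]]]].
have [n0|n0] := eqVneq n 0%N.
  exists z; first exact: conv_mem.
  rewrite n0 scale0r big1 // => i _; apply/eqP; rewrite scaler_eq0; apply/orP; left.
  apply: contraT => li; move: lE; rewrite n0 (bigD1 i) //= => /eqP.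
  by rewrite paddr_eq0 ?sumr_ge0 // (negPf li).
exists (\sum_i (l i / n%:R) *: y i).
  exists k, y, (fun i => l i / n%:R); split=> // [i|]; first exact: divr_ge0.
  by rewrite -mulr_suml lE divff ?pnatr_eq0.
rewrite scaler_sumr; apply: eq_bigr => i _.
by rewrite scalerA mulrC divfK ?pnatr_eq0.
Qed.

(** Integer points of the hull other than those of A add nothing to the cone,
    since they are convex combinations of points of A. *)
Lemma polytope_cone_conv A :
  (forall x, A x -> exists z, x = int_to_real R z) ->
  polytope_cone (conv A) = generated_cone (homogenize A).
Proof.
move=> Aint; apply/seteqP; split; apply: generated_cone_sub => _ [x Ax <-].
  apply/homogenize_coneP; have [k [y [l lP]]] := Ax.
  by exists k, y, l.
have [z xE] := Aint x Ax; apply: generated_cone_mem; exists z; last by rewrite xE.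
by rewrite /integer_points /= -xE; apply: conv_mem.
Qed.

End Homogenization.

(** * The cone over the lifting points *)

Section Lifting.
Variables (R : realType) (s p m : nat) (v : 'I_m -> 'rV[nat]_s).
Variable w : 'I_p -> {linear 'rV[R]_s -> R^o}.
Local Notation base_points := (range (fun i => nat_to_real R (v i))).
Local Notation Gamma := (lifting_Gamma v w).

Definition scaled_weights (theta : 'I_p -> R) (x : 'rV[R]_s) : 'rV[R]_p :=
  \row_j (theta j * w j x).

Lemma lifting_pointE (x : 'rV[R]_s) (J : {set 'I_p}) :
  row_mx x 0 + \sum_(j in J) w j x *: delta_mx ord0 (rshift s j) =
  row_mx x (scaled_weights (fun j => (j \in J)%:R) x) :> 'rV[R]_(s + p).
Proof.
apply/rowP => i; rewrite mxE summxE; case: (split_ordP i) => j ->.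
  rewrite !row_mxEl big1 ?addr0 // => i' _.
  by rewrite !mxE eq_lrshift andbF mulr0.
rewrite !row_mxEr !mxE add0r big_mkcond (bigD1 j) //= big1 ?addr0 => [|i' i'j].
  by case: ifP => _; rewrite ?mul0r // !mxE !eqxx mulr1 mul1r.
case: ifP => // _; rewrite !mxE eq_rshift (eq_sym j) (negPf i'j) andbF.
by rewrite mulr0.
Qed.

(** For fixed theta this is linear in x; it sends (a, t) to (a, theta w(a), t),
    and every point of the lifted cone is of this form for some theta. *)
Definition lift_by (theta : 'I_p -> R) (x : 'rV[R]_(s + 1)) : 'rV[R]_(s + p + 1) :=
  row_mx (row_mx (lsubmx x) (scaled_weights theta (lsubmx x))) (rsubmx x).

Lemma scaled_weightsD theta x y :
  scaled_weights theta (x + y) = scaled_weights theta x + scaled_weights theta y.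
Proof. by apply/rowP => j; rewrite !mxE linearD mulrDr. Qed.

Lemma scaled_weightsZ theta l x :
  scaled_weights theta (l *: x) = l *: scaled_weights theta x.
Proof. by apply/rowP => j; rewrite !mxE linearZ /= mulrCA. Qed.

Lemma lift_byD theta x y : lift_by theta (x + y) = lift_by theta x + lift_by theta y.
Proof. by rewrite /lift_by !linearD /= scaled_weightsD !add_row_mx. Qed.

Lemma lift_byZ theta l x : lift_by theta (l *: x) = l *: lift_by theta x.
Proof. by rewrite /lift_by !linearZ /= scaled_weightsZ !scale_row_mx. Qed.

(** The probability that J is drawn when each j is selected independently with
    probability theta j. *)
Definition cube_weight (theta : 'I_p -> R) (J : {set 'I_p}) : R :=
  \prod_j (if j \in J then theta j else 1 - theta j).

Lemma cube_weight_sum theta : \sum_J cube_weight theta J = 1.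
Proof.
transitivity (\sum_(J in {set 'I_p}) cube_weight theta J); first exact: eq_bigl.
by rewrite /cube_weight -bigA_distr big1 //= => j _; rewrite addrC subrK.
Qed.

(** Replacing the factor 1 - theta i by 0 removes exactly the subsets that
    miss i; expanding the product then leaves theta i. *)
Lemma cube_weight_sum_mem theta i :
  \sum_J cube_weight theta J * (i \in J)%:R = theta i.
Proof.
pose c j := if j == i then 0 else 1 - theta j.
transitivity (\sum_(J in {set 'I_p}) \prod_j (if j \in J then theta j else c j)).
  apply: eq_big => // J _; have [iJ|iJ] := boolP (i \in J).
    rewrite mulr1; apply: eq_bigr => j _; rewrite /c.
    by case: ifP => // jJ; case: eqP iJ => // <-; rewrite jJ.
  by rewrite mulr0 (bigD1 i) //= (negPf iJ) /c eqxx mul0r.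
rewrite -bigA_distr (bigD1 i) //= /c eqxx addr0 big1 ?mulr1 //= => j /negPf ->.
by rewrite addrC subrK.
Qed.

(** A point of the box with sides [0, w_j(x)] is the mean of its corners for the
    weights [cube_weight]. *)
Lemma lift_by_cube theta (x : 'rV[R]_s) :
  lift_by theta (row_mx x 1%:M) =
  \sum_J cube_weight theta J *:
    row_mx (row_mx x (scaled_weights (fun j => (j \in J)%:R) x)) 1%:M.
Proof.
under eq_bigr do rewrite !scale_row_mx scale_scalar_mx mulr1.
rewrite !row_mx_sum -raddf_sum /=.
rewrite -scaler_suml cube_weight_sum scale1r /lift_by row_mxKl row_mxKr.
congr (row_mx (row_mx _ _) _); apply/rowP => j.
rewrite summxE mxE -(cube_weight_sum_mem theta j) mulr_suml.
by apply: eq_bigr => J _; rewrite !mxE mulrA.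
Qed.

Lemma lift_by_cone theta x : (forall j, 0 <= theta j <= 1) ->
  generated_cone (homogenize base_points) x -> generated_cone Gamma (lift_by theta x).
Proof.
move=> th01; move: x; apply: generated_cone_ind => [|x y Gx Gy|l _ l0 [_ [i _ <-] <-]].
- by rewrite -(scale0r 0) lift_byZ scale0r; apply: generated_cone0.
- by rewrite lift_byD; apply: generated_coneD.
rewrite lift_byZ; apply: generated_coneZ => //.
rewrite lift_by_cube; apply: generated_cone_sum => J; apply: generated_coneZ.
  rewrite prodr_ge0 // => j _; have /andP[th0 th1] := th01 j.
  by case: ifP; rewrite ?subr_ge0.
apply: generated_cone_mem; rewrite -lifting_pointE.
by eexists; [exists i, J; reflexivity|].
Qed.

Hypothesis w_ge0 : forall j i, 0 <= w j (nat_to_real R (v i)).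

(** The inequalities are preserved by nonnegative combinations. Conversely,
    they say that b = theta w(a) with theta_j = b_j / w_j(a) in [0, 1], and
    [lift_by_cone] applies. *)
Lemma Gamma_coneP (a : 'rV[R]_s) (b : 'rV[R]_p) (t : 'M[R]_1) :
  generated_cone Gamma (row_mx (row_mx a b) t) <->
  generated_cone (homogenize base_points) (row_mx a t) /\
  forall j, 0 <= b ord0 j <= w j a.
Proof.
split=> [Gabt|[Ca b_le]].
  pose P (x : 'rV[R]_(s + p + 1)) :=
    generated_cone (homogenize base_points) (row_mx (lsubmx (lsubmx x)) (rsubmx x)) /\
    forall j, 0 <= rsubmx (lsubmx x) ord0 j <= w j (lsubmx (lsubmx x)).
  suff : P (row_mx (row_mx a b) t) by rewrite /P !(row_mxKl, row_mxKr).
  apply: generated_cone_ind Gabt => [|x y [Cx bx] [Cy by_]|l _ l0 [_ [i [J ->]] <-]].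
  - split=> [|j]; first by rewrite !raddf0 row_mx0; apply: generated_cone0.
    by rewrite !raddf0 mxE lexx.
  - split=> [|j]; first by rewrite !raddfD -add_row_mx; apply: generated_coneD.
    have /andP[x0 xw] := bx j; have /andP[y0 yw] := by_ j.
    by rewrite !raddfD mxE addr_ge0 ?lerD.
  - rewrite lifting_pointE; split=> [|j]; rewrite !linearZ /= !(row_mxKl, row_mxKr).
      rewrite -scale_row_mx; apply: generated_coneZ => //.
      by apply: generated_cone_mem; eexists; [exists i|].
    rewrite !mxE mulr_ge0 ?mulr_ge0 //= ler_wpM2l //.
    by case: (_ \in J); rewrite ?mul1r ?mul0r.
pose theta j := b ord0 j / w j a.
(* When w_j(a) = 0 also b_j = 0, and theta_j = 0 since x / 0 = 0. *)
have -> : row_mx (row_mx a b) t = lift_by theta (row_mx a t).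
  rewrite /lift_by row_mxKl row_mxKr; congr (row_mx (row_mx _ _) _).
  apply/rowP => j; rewrite mxE /theta; have [w0|w0] := eqVneq (w j a) 0.
    by have := b_le j; rewrite w0 mulr0 -eq_le => /eqP.
  by rewrite divfK.
apply: lift_by_cone => // j; have /andP[b0 bw] := b_le j.
have w0 := le_trans b0 bw; rewrite /theta divr_ge0 //=.
move: w0; rewrite le_eqVlt => /orP[/eqP <-|w0]; first by rewrite invr0 mulr0.
by rewrite ler_pdivrMr ?mul1r.
Qed.

End Lifting.

(** * Nonnegative integer combinations *)

Section NatSpan.
Variable N : nat.
Implicit Types (H : set 'rV[int]_N) (x y : 'rV[int]_N).

Lemma nat_span0 H : nat_span H 0.
Proof. by exists 0%N, (fun=> 0), (fun=> 0%N); split=> [[]//|]; rewrite big_ord0. Qed.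

Lemma nat_span_ind H (P : 'rV[int]_N -> Prop) : P 0 ->
  (forall x y, P x -> P y -> P (x + y)) -> (forall h, H h -> P h) ->
  forall x, nat_span H x -> P x.
Proof.
move=> P0 PD PH x [k [y [l [Hy ->]]]]; elim/big_ind: _ => // i _.
by elim: (l i) => [|n IH]; rewrite ?mulr0n // mulrS; apply: PD => //; apply: PH.
Qed.

Lemma nat_span_consMn H h n x : H h -> nat_span H x -> nat_span H (h *+ n + x).
Proof.
move=> Hh [k [y [l [Hy ->]]]].
exists k.+1, (fun i => oapp y h (unlift ord0 i)), (fun i => oapp l n (unlift ord0 i)).
split=> [i|]; first by case: unlift => /=.
rewrite big_ord_recl unlift_none /=; congr (_ + _).
by apply: eq_bigr => i _; rewrite liftK.
Qed.

Lemma nat_spanD H x y : nat_span H x -> nat_span H y -> nat_span H (x + y).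
Proof.
move=> [k [z [l [Hz ->]]]] Hy; elim/big_rec: _ => [|i a _ Ha]; first by rewrite add0r.
by rewrite -addrA; apply: nat_span_consMn.
Qed.

Lemma nat_span_mem H h : H h -> nat_span H h.
Proof.
by move=> Hh; rewrite -[h]addr0 -[h]mulr1n; apply: nat_span_consMn (nat_span0 H).
Qed.

(** The zero vector is left out: it does not change the span but its factor
    1 - X^0 would make the denominator of the series vanish. *)
Lemma nat_span_finite H : finite_set H -> (forall h, H h -> forall i, 0 <= h ord0 i) ->
  exists2 hs : seq 'X_{1..N}, 0%MM \notin hs &
    nat_span H = monoid_of (map (@mnm_to_int N) hs).
Proof.
move=> /finite_seqP[r HE] H0.
pose e (h : 'rV[int]_N) := [multinom absz (h ord0 i) | i < N].
have eK h : H h -> mnm_to_int (e h) = h.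
  by move=> Hh; apply/rowP => i; rewrite mxE mnmE gez0_abs // H0.
exists [seq e h | h <- r & h != 0].
  apply/mapP => -[h]; rewrite mem_filter => /andP[/eqP h0 hr] eh0; apply: h0.
  by rewrite -(eK h) ?HE // -eh0 mnm_to_int0.
apply/seteqP; split; last first.
  apply: monoid_of_ind; [exact: nat_span0|exact: nat_spanD|move=> h].
  rewrite -map_comp => /mapP[g]; rewrite mem_filter => /andP[_ gr] ->.
  by apply: nat_span_mem; rewrite /= eK HE.
apply: nat_span_ind; [exact: monoid_of0|exact: monoid_ofD|move=> h Hh].
have [->|h0] := eqVneq h 0; first exact: monoid_of0.
apply: monoid_of_mem; rewrite -(eK h) //; do 2 apply: map_f.
by rewrite mem_filter h0; move: Hh; rewrite HE.
Qed.

End NatSpan.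

(** * Integer points of the lifted cone *)

Section IntegerPoints.
Variables (R : realType) (N : nat).

Lemma int_to_realD (x y : 'rV[int]_N) :
  int_to_real R (x + y) = int_to_real R x + int_to_real R y.
Proof. by apply/rowP => i; rewrite !mxE intrD. Qed.

Lemma int_to_real0 : int_to_real R (0 : 'rV[int]_N) = 0.
Proof. by apply/rowP => i; rewrite !mxE. Qed.

Lemma int_to_real_row (n : nat) (a : 'rV[int]_N) (b : 'rV[int]_n) :
  int_to_real R (row_mx a b) = row_mx (int_to_real R a) (int_to_real R b).
Proof. exact: map_row_mx. Qed.

Lemma int_to_real_scalar (t : int) :
  int_to_real R (t%:M : 'rV[int]_1) = (t%:~R)%:M.
Proof. by apply/rowP => i; rewrite !mxE !ord1 eqxx. Qed.

Lemma integer_cone0 (A : set 'rV[R]_N) : integer_points (generated_cone A) 0.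
Proof. by rewrite /integer_points /= int_to_real0; apply: generated_cone0. Qed.

Lemma integer_coneD (A : set 'rV[R]_N) x y : integer_points (generated_cone A) x ->
  integer_points (generated_cone A) y -> integer_points (generated_cone A) (x + y).
Proof. by rewrite /integer_points /= int_to_realD; apply: generated_coneD. Qed.

End IntegerPoints.

(** This one enumeration serves for finiteness and for counting. *)
Lemma box_enum (p : nat) (u : 'I_p -> nat) :
  exists r : seq 'rV[int]_p, [/\ uniq r, size r = (\prod_j (u j).+1)%N &
    forall b : 'rV[int]_p, (b \in r) <-> forall j, 0 <= b ord0 j <= Posz (u j)].
Proof.
pose e (f : {dffun forall j : 'I_p, 'I_(u j).+1}) : 'rV[int]_p := \row_j Posz (f j).
have e_inj : injective e.
  move=> f g /rowP fg; apply/ffunP => j; apply: val_inj.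
  by have := fg j; rewrite !mxE => -[].
exists (map e (enum {: {dffun forall j : 'I_p, 'I_(u j).+1}})); split.
- by rewrite map_inj_uniq // enum_uniq.
- rewrite size_map -cardE card_dep_ffun foldrE big_map big_enum /=.
  by apply: eq_bigr => j _; rewrite card_ord.
- move=> b; split=> [/mapP[f _ ->] j|b_box].
    by rewrite mxE le0z_nat lez_nat -ltnS ltn_ord.
  apply/mapP; exists (finfun (fun j => inord (absz (b ord0 j)))).
    by rewrite mem_enum.
  apply/rowP => j; have /andP[b0 bu] := b_box j; rewrite mxE ffunE inordK ?gez0_abs //.
  by rewrite ltnS -lez_nat gez0_abs.
Qed.

Section IntegerLifting.
Variables (R : realType) (s p m r : nat) (v : 'I_m -> 'rV[nat]_s).
Variable w : 'I_p -> {linear 'rV[R]_s -> R^o}.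
Variable W : 'I_p -> 'I_s -> nat.
Hypothesis wE : forall j l, w j (delta_mx ord0 l) = (W j l)%:R.
Variables (c : 'I_r -> 'rV[nat]_s) (d : 'I_r -> nat).
Local Notation P := (lattice_polytope R v).
Local Notation base_points := (range (fun i => nat_to_real R (v i))).
Local Notation Gamma := (lifting_Gamma v w).
Local Notation E := (weighted_exponents P w).

Definition int_weight (a : 'rV[int]_s) (j : 'I_p) : int :=
  \sum_l a ord0 l * (W j l)%:Z.

Lemma int_weightE a j : w j (int_to_real R a) = (int_weight a j)%:~R.
Proof.
rewrite (row_sum_delta (int_to_real R a)) linear_sum rmorph_sum /=.
by apply: eq_bigr => l _; rewrite linearZ /= wE mxE rmorphM.
Qed.

Lemma int_weightD a a' j : int_weight (a + a') j = int_weight a j + int_weight a' j.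
Proof. by rewrite -big_split; apply: eq_bigr => l _; rewrite mxE mulrDl. Qed.

Lemma int_weight0 j : int_weight 0 j = 0.
Proof. by rewrite /int_weight big1 // => l _; rewrite mxE mul0r. Qed.

Lemma int_weight_ge0 (a : 'rV[int]_s) j :
  (forall l, 0 <= a ord0 l) -> 0 <= int_weight a j.
Proof. by move=> a0; apply: sumr_ge0 => l _; rewrite mulr_ge0. Qed.

Lemma nat_to_int_ge0 (N : nat) (a : 'rV[nat]_N) l : 0 <= nat_to_int a ord0 l.
Proof. by rewrite mxE. Qed.

Lemma weight_vertex_ge0 j i : 0 <= w j (nat_to_real R (v i)).
Proof. by rewrite int_weightE ler0z int_weight_ge0 // => l; apply: nat_to_int_ge0. Qed.

Lemma polytope_cone_base : polytope_cone P = generated_cone (homogenize base_points).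
Proof. by apply: polytope_cone_conv => _ [i _ <-]; exists (nat_to_int (v i)). Qed.

(** By linearity w_j takes integer values at integer points. *)
Lemma lifting_points_integral x : lifting_points v w x -> exists z, x = int_to_real R z.
Proof.
move=> [i [J ->]]; rewrite lifting_pointE.
exists (row_mx (nat_to_int (v i))
  (\row_j (if j \in J then int_weight (nat_to_int (v i)) j else 0))).
rewrite int_to_real_row; congr row_mx; apply/rowP => j; rewrite !mxE int_weightE.
by case: (j \in J); rewrite ?mul1r ?mul0r.
Qed.

Lemma polytope_cone_lifting :
  polytope_cone (lifting_polytope v w) = generated_cone Gamma.
Proof. exact: polytope_cone_conv lifting_points_integral. Qed.

Lemma weighted_exponentsP a b (t : 'M[int]_1) :
  E (row_mx (row_mx a b) t) <-> integer_points (polytope_cone P) (row_mx a t) /\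
    forall j, 0 <= b ord0 j <= int_weight a j.
Proof.
split=> [[a' [b' [n [Ca bw /eq_row_mx[/eq_row_mx[-> ->] ->]]]]]|[Ca bw]].
  split=> // j; have [b0] := bw j.
  by rewrite int_weightE ler_int b0 => ->.
exists a, b, (t 0 0); rewrite -mx11_scalar; split=> // j; have /andP[b0 b1] := bw j.
by rewrite int_weightE ler_int b0.
Qed.

Lemma integer_points_Gamma : integer_points (generated_cone Gamma) = E.
Proof.
apply/seteqP; split=> x; rewrite -[x]hsubmxK -[lsubmx x]hsubmxK;
  move: (lsubmx (lsubmx x)) (rsubmx (lsubmx x)) (rsubmx x) => a b t.
  rewrite /integer_points /= !int_to_real_row.
  move/(Gamma_coneP weight_vertex_ge0) => [Ca bw]; apply/weighted_exponentsP.
  split=> [|j]; first by rewrite /integer_points /= int_to_real_row polytope_cone_base.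
  by have := bw j; rewrite mxE int_weightE ler0z ler_int.
move/weighted_exponentsP => [Ca bw].
rewrite /integer_points /= !int_to_real_row; apply/(Gamma_coneP weight_vertex_ge0).
split=> [|j]; first by rewrite -int_to_real_row -polytope_cone_base.
by have := bw j; rewrite mxE int_weightE ler0z ler_int.
Qed.

Hypothesis cd_hilbert : hilbert_basis (base_vectors c d) (polytope_cone P).
Local Notation H := (lifted_vectors P w c d).

Lemma base_vector_cone i : integer_points (polytope_cone P)
  (row_mx (nat_to_int (c i)) (Posz (d i))%:M).
Proof. by rewrite cd_hilbert; apply: nat_span_mem; exists i. Qed.

Lemma lifted_vectors_sub : H `<=` E.
Proof.
move=> _ [i [b [bw _ ->]]]; apply/weighted_exponentsP; split=> [|j].
  exact: base_vector_cone.
have := bw j; rewrite int_weightE mxE -[_%:R]/((Posz (b ord0 j))%:~R) ler_int.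
by rewrite le0z_nat.
Qed.

(** If P is not empty the vector is a lifted generator: membership of
    (c_i, d_i) in the cone means that c_i is in d_i P. If P is empty, its cone
    is 0; the lifted vectors then form the empty set, but (c_i, d_i) is 0, and
    so is b. *)
Lemma lift_base_vector i (b : 'rV[int]_p) :
  (forall j, 0 <= b ord0 j <= int_weight (nat_to_int (c i)) j) ->
  nat_span H (row_mx (row_mx (nat_to_int (c i)) b) (Posz (d i))%:M).
Proof.
move=> bw; have := base_vector_cone i; rewrite /integer_points /= int_to_real_row.
rewrite int_to_real_scalar polytope_cone_base => Cc.
have [ne|empty] := pselect (base_points !=set0).
  apply: nat_span_mem; exists i, (\row_j absz (b ord0 j)).
  have bE : nat_to_int (\row_j absz (b ord0 j)) = b.
    by apply/rowP => j; rewrite !mxE gez0_abs //; have /andP[] := bw j.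
  split=> [j||]; last by rewrite bE.
    rewrite int_weightE mxE -[_%:R]/((Posz `|b ord0 j|)%:~R) ler_int.
    by have /andP[b0] := bw j; rewrite gez0_abs.
  exact/dilate_convP.
have /eqP : row_mx (nat_to_real R (c i)) (d i)%:R%:M = 0 :> 'rV[R]_(s + 1).
  move: Cc; apply: (@generated_cone_ind _ _ _ (fun x => x = 0)) => //.
  - by move=> x y -> ->; rewrite addr0.
  - by move=> l _ _ [y By <-]; case: empty; exists y.
rewrite row_mx_eq0 => /andP[/eqP c0 /eqP d0].
have {}c0 : nat_to_int (c i) = 0.
  apply/rowP => l; move/rowP/(_ l): c0; rewrite !mxE => /eqP.
  by rewrite intr_eq0 => /eqP.
have {}d0 : (Posz (d i))%:M = 0 :> 'rV[int]_1.
  apply/rowP => l; move/rowP/(_ l): d0; rewrite !mxE ord1 eqxx => /eqP.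
  by rewrite pnatr_eq0 => /eqP ->.
have {}b0 : b = 0.
  apply/rowP => j; have := bw j; rewrite c0 int_weight0 mxE -eq_le.
  by move=> /eqP.
by rewrite c0 d0 b0 !row_mx0; apply: nat_span0.
Qed.

(** The inclusion of E in the span is proved by induction along a
    decomposition of (a, n) into base vectors, for all admissible b at once: if
    a = a1 + a2, give min(b_j, w_j(a1)) to the first part; what is left over
    does not exceed w_j(a2). *)
Lemma nat_span_lifted_vectors : nat_span H = E.
Proof.
apply/seteqP; split.
  rewrite -integer_points_Gamma; apply: nat_span_ind.
  - exact: integer_cone0.
  - exact: integer_coneD.
  - by rewrite integer_points_Gamma; apply: lifted_vectors_sub.
move=> x; rewrite -[x]hsubmxK -[lsubmx x]hsubmxK.
move: (lsubmx (lsubmx x)) (rsubmx (lsubmx x)) (rsubmx x) => a b t.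
move/weighted_exponentsP => [Ca bw].
(* The weights must be carried along as nonnegative: if b_j <= w_j(a1) the
   second part gets 0, which has to be at most w_j(a2). *)
pose Q (y : 'rV[int]_(s + 1)) := (forall j, 0 <= int_weight (lsubmx y) j) /\
  forall b' : 'rV[int]_p, (forall j, 0 <= b' ord0 j <= int_weight (lsubmx y) j) ->
  nat_span H (row_mx (row_mx (lsubmx y) b') (rsubmx y)).
suff [_ /(_ b)] : Q (row_mx a t) by rewrite row_mxKl row_mxKr; apply.
move: Ca; rewrite cd_hilbert; apply: nat_span_ind => [|x1 x2 [W1 Q1] [W2 Q2]|_ [i _ <-]].
- split=> [j|b0 b0w]; rewrite !raddf0 ?int_weight0 //.
  have -> : b0 = 0; last by rewrite !row_mx0; apply: nat_span0.
  apply/rowP => j; have := b0w j; rewrite raddf0 int_weight0 mxE -eq_le.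
  by move=> /eqP.
- split=> [j|b0 b0w]; first by rewrite raddfD int_weightD addr_ge0.
  pose b1 := \row_j Order.min (b0 ord0 j) (int_weight (lsubmx x1) j).
  have -> : row_mx (row_mx (lsubmx (x1 + x2)) b0) (rsubmx (x1 + x2)) =
      row_mx (row_mx (lsubmx x1) b1) (rsubmx x1) +
      row_mx (row_mx (lsubmx x2) (b0 - b1)) (rsubmx x2).
    by rewrite !add_row_mx !raddfD /= [b1 + _]addrC subrK.
  apply: nat_spanD; [apply: Q1|apply: Q2] => j;
    have /andP[b0_ge0] := b0w j; rewrite raddfD int_weightD !mxE => b0_le.
    by rewrite le_min b0_ge0 W1 ge_min lexx orbT.
  have [le1|/ltW le1] := leP (b0 ord0 j) (int_weight (lsubmx x1) j).
    by rewrite subrr lexx W2.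
  by rewrite subr_ge0 le1 lerBlDl.
- rewrite /Q row_mxKl row_mxKr; split=> [j|b0]; last exact: lift_base_vector.
  by apply: int_weight_ge0 => l; apply: nat_to_int_ge0.
Qed.

Lemma lifted_vectors_finite : finite_set H.
Proof.
have /choice[box boxP] i := box_enum (fun j => absz (int_weight (nat_to_int (c i)) j)).
pose q := [seq row_mx (row_mx (nat_to_int (c i)) b) (Posz (d i))%:M |
  i <- enum 'I_r, b <- box i].
apply: sub_finite_set (finite_seq q) => x Hx; have Ex := lifted_vectors_sub Hx.
have [i [b [bw _ xE]]] := Hx; rewrite xE in Ex *.
have /weighted_exponentsP[_ {}bw] := Ex.
apply/allpairsPdep; exists i, (nat_to_int b); split; rewrite ?mem_enum //.
have [_ _ ->] := boxP i; move=> j; rewrite gez0_abs //.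
by apply: int_weight_ge0 => l; apply: nat_to_int_ge0.
Qed.

Lemma lifted_vectors_ge0 h : H h -> forall i, 0 <= h ord0 i.
Proof.
move=> [i [b [_ _ ->]]] l; case: (split_ordP l) => {}l ->; rewrite ?row_mxEl ?row_mxEr.
  case: (split_ordP l) => {}l ->; rewrite ?row_mxEl ?row_mxEr; exact: nat_to_int_ge0.
by rewrite mxE; case: (_ == _).
Qed.

Lemma weighted_series_rational : is_rational_function (weighted_ehrhart_series P w).
Proof.
rewrite /weighted_ehrhart_series -nat_span_lifted_vectors.
have [hs hs0 ->] := nat_span_finite lifted_vectors_finite lifted_vectors_ge0.
exact: rational_monoid.
Qed.

End IntegerLifting.

(** * Counting integer points *)

Section Counting.
Variables (R : realType) (s p m : nat) (v : 'I_m -> 'rV[nat]_s).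
Variable w : 'I_p -> {linear 'rV[R]_s -> R^o}.
Variable W : 'I_p -> 'I_s -> nat.
Hypothesis wE : forall j l, w j (delta_mx ord0 l) = (W j l)%:R.
Local Notation P := (lattice_polytope R v).
Local Notation Pw := (lifting_polytope v w).

(** A crude bound suffices: each coordinate of a vertex is at most the sum of
    that coordinate over all vertices. *)
Lemma dilate_polytope_box n (a : 'rV[int]_s) : integer_points (dilate n P) a ->
  forall l, 0 <= a ord0 l <= Posz (n * \sum_i v i ord0 l).
Proof.
move=> [x [k [y [lam [Py lam0 lam1 xE]]]] ax] l.
have y_le i : 0 <= y i ord0 l <= (\sum_i v i ord0 l)%:R.
  have [i' _ <-] := Py i; rewrite !mxE ler0z le0z_nat /= -[_%:~R]/(_%:R) ler_nat.
  by rewrite (bigD1 i') //= leq_addr.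
have aE : (a ord0 l)%:~R = n%:R * \sum_i lam i * y i ord0 l :> R.
  move/rowP/(_ l): ax; rewrite !mxE => <-; rewrite xE summxE; congr (_ * _).
  by apply: eq_bigr => i _; rewrite mxE.
rewrite -(ler0z R) -(ler_int R) aE; apply/andP; split.
  rewrite mulr_ge0 // sumr_ge0 // => i _; rewrite mulr_ge0 //.
  by have /andP[] := y_le i.
rewrite -[_%:~R]/((n * _)%:R) natrM ler_wpM2l //.
set M := (X in _ <= X); rewrite -(mul1r M) -lam1 mulr_suml.
by apply: ler_sum => i _; rewrite ler_wpM2l //; have /andP[] := y_le i.
Qed.

Lemma dilate_polytope_finite n : finite_set (integer_points (dilate n P)).
Proof.
have [r [_ _ rP]] := box_enum (fun l => n * \sum_i v i ord0 l)%N.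
by apply: sub_finite_set (finite_seq r) => a /dilate_polytope_box /rP.
Qed.

Lemma dilate_liftingP n (a : 'rV[int]_s) (b : 'rV[int]_p) :
  integer_points (dilate n Pw) (row_mx a b) <->
  integer_points (dilate n P) a /\ forall j, 0 <= b ord0 j <= int_weight W a j.
Proof.
have bE j : (0 <= int_to_real R b ord0 j <= w j (int_to_real R a)) =
    (0 <= b ord0 j <= int_weight W a j).
  by rewrite (int_weightE wE) mxE ler0z ler_int.
rewrite /integer_points /= int_to_real_row; split.
  move/dilate_convP => [[_ [i _]]] /(Gamma_coneP (weight_vertex_ge0 v wE))[Ca bw].
  split=> [|j]; last by rewrite -bE.
  by apply/dilate_convP; split=> //; exists (nat_to_real R (v i)); exists i.
move=> [/dilate_convP[[_ [i _ _]] Ca] bw]; apply/dilate_convP; split.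
  by eexists; exists i, finset.set0; reflexivity.
by apply/(Gamma_coneP (weight_vertex_ge0 v wE)); split=> // j; rewrite bE.
Qed.

(** Projecting to the first s coordinates, the fibre over a is the box with
    sides [0, w_j(a)]. Enumerating the fibres one after the other lists every
    integer point exactly once. *)
Lemma ehrhart_lifting n : (ehrhart Pw n)%:R =
  weighted_ehrhart P (fun a => \prod_(i < p) ((w i (int_to_real R a) : R) + 1)) n.
Proof.
have /choice[box boxP] a := box_enum (fun j => absz (int_weight W a j)).
have Afin := dilate_polytope_finite n; set A := integer_points (dilate n P) in Afin.
pose r := fset_set A; pose q := [seq row_mx a b | a <- r, b <- box a].
have W0 a j : a \in r -> 0 <= int_weight W a j.
  rewrite in_fset_set // inE => Aa; apply: int_weight_ge0 => l.
  by have /andP[] := dilate_polytope_box Aa l.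
have qE : integer_points (dilate n Pw) = [set` q].
  apply/seteqP; split=> x; rewrite -[x]hsubmxK;
    move: (lsubmx x) (rsubmx x) => {x} a b.
    move=> /dilate_liftingP[Aa bw]; have ar : a \in r by rewrite in_fset_set ?inE.
    apply/allpairsPdep; exists a, b; split=> //.
    by have [_ _ ->] := boxP a; move=> j; rewrite gez0_abs ?W0.
  move=> /allpairsPdep[a' [b' [ar bx /eq_row_mx[aE bE]]]]; subst a' b'.
  apply/dilate_liftingP; split; first by move: ar; rewrite in_fset_set ?inE.
  have [_ _ /(_ b)[/(_ bx) bw _]] := boxP a.
  by move=> j; have := bw j; rewrite gez0_abs ?W0.
have q_uniq : uniq q.
  apply: allpairs_uniq_dep => [|a _|]; first exact: fset_uniq.
    by have [] := boxP a.
  move=> [a b] [a' b'] _ _ /= /eq_row_mx[-> ->]; reflexivity.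
have -> : ehrhart Pw n = size q.
  rewrite /ehrhart qE.
  have -> : [set` q] = [set` [fset x in q]%fset].
    by apply/seteqP; split=> x /=; rewrite inE.
  by rewrite set_fsetK card_fseq undup_id.
rewrite /weighted_ehrhart fsbig_finite //= size_allpairs_dep sumnE big_map natr_sum.
rewrite big_seq [RHS]big_seq; apply: eq_bigr => a ar.
have [_ -> _] := boxP a; rewrite natr_prod; apply: eq_bigr => j _.
by rewrite (int_weightE wE) -natr1 -[X in _ = X%:~R + _](gez0_abs (W0 a j ar)).
Qed.

End Counting.

(** * The theorem *)

Theorem theorem4p6 (R : realType) (K : fieldType) (iota : {rmorphism R -> K})
    (s p m r : nat) (v : 'I_m -> 'rV[nat]_s)
    (w : 'I_p -> {linear 'rV[R]_s -> R^o})
    (w_nat : forall (i : 'I_p) (j : 'I_s),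
       exists k : nat, w i (delta_mx ord0 j) = k%:R)
    (c : 'I_r -> 'rV[nat]_s) (d : 'I_r -> nat)
    (cd_hilbert :
       hilbert_basis (base_vectors c d) (polytope_cone (lattice_polytope R v))) :
  let P := lattice_polytope R v in
  let Pw := lifting_polytope v w in
  let HPw := lifted_vectors P w c d in
  [/\ hilbert_basis HPw (generated_cone (lifting_Gamma v w)),
      weighted_ehrhart_ring K P w = monomial_subring K (nat_span HPw),
      ehrhart_ring K Pw = weighted_ehrhart_ring K P w,
      forall n : nat,
        (ehrhart Pw n)%:R =
        weighted_ehrhart P
          (fun a => \prod_(i < p) ((w i (int_to_real R a) : R) + 1)) n
    & is_rational_function (weighted_ehrhart_series P w)].
Proof.
have /choice[W wE] j : exists W : 'I_s -> nat,
    forall l, w j (delta_mx ord0 l) = (W l)%:R.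
  by have [W wE] := choice (w_nat j); exists W.
move=> P Pw HPw.
have HE : nat_span HPw = weighted_exponents P w.
  exact: (nat_span_lifted_vectors wE cd_hilbert).
have GE : integer_points (generated_cone (lifting_Gamma v w)) = weighted_exponents P w.
  exact: integer_points_Gamma wE.
split.
- by rewrite /hilbert_basis GE HE.
- by rewrite HE.
- by rewrite /ehrhart_ring (polytope_cone_lifting v wE) GE.
- exact: ehrhart_lifting wE.
- exact: (weighted_series_rational wE cd_hilbert).
Qed.
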